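(* Let $\Phi$ be a root system with Weyl group $W$ and a fixed set of positive roots $\Phi^+$, and let $m=|\Phi^+|$. Let $0\le n<m$ be an integer and let $M$ be a set of representatives of the $W$-conjugacy classes of special closed subsets of $\Phi$ of cardinality $n+1$ (exactly one from each class). Consider the following algorithm. (1) Set $L=\emptyset$. (2) For each $T\in M$ do: (a) compute the stabilizer $W_T=\{w\in W\mid w(T)=T\}$; (b) compute the orbits of $W_T$ on $T\setminus(T+T)$; (c) for each such orbit take a representative $\alpha$ and set $S=T\setminus\{\alpha\}$; if $S$ is not $W$-conjugate to any element of $L$, then add $S$ to $L$. (3) Return $L$. The output $L$ is a set of representatives of the $W$-conjugacy classes of special closed subsets of $\Phi$ of cardinality $n$ (exactly one from each class). Consequently, starting with the set $\{\Phi^+\}$ for cardinality $m$ and iterating this algorithm, one obtains the special closed subsets of $\Phi$ of cardinalities $m-1,m-2,\ldots,1$ up to conjugacy by $W$, and hence, together with $\Phi^+$, all nonempty special closed subsets of $\Phi$ up to conjugacy by $W$.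
   Context: A root system $\Phi$ in a Euclidean space $E$ is a finite set spanning $E$, not containing $0$, such that the only multiples of $\alpha\in\Phi$ in $\Phi$ are $\pm\alpha$, invariant under the reflections $s_\alpha$ ($\alpha\in\Phi$), and with $2(\beta,\alpha)/(\alpha,\alpha)\in\mathbb{Z}$ for $\alpha,\beta\in\Phi$. Its Weyl group $W$ is generated by the $s_\alpha$, $\alpha\in\Phi$. A subset $T\subseteq\Phi$ is closed if for all $\alpha,\beta\in T$, $\alpha+\beta\in\Phi$ implies $\alpha+\beta\in T$. A closed set $T$ is special if there is no $\alpha\in T$ with $-\alpha\in T$. Closed sets $T,T'$ are conjugate if $w(T)=T'$ for some $w\in W$. For a closed set $T$, $T+T$ denotes the set of all $\gamma\in T$ such that $\gamma=\alpha+\beta$ for certain $\alpha,\beta\in T$. *)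

(* Defs.v *)
From mathcomp Require Import all_boot all_order all_algebra finmap.
From mathcomp Require Import boolp reals.

Set Implicit Arguments.
Unset Strict Implicit.
Unset Printing Implicit Defensive.

Import Order.TTheory GRing.Theory Num.Theory.

Local Open Scope fset_scope.
Local Open Scope ring_scope.

(* A Euclidean space is a finite-dimensional vector space E over the reals R
   together with a symmetric positive definite bilinear form
   ip : {dot E for idfun}. *)

Definition reflection (R : realType) (E : vectType R) (ip : {dot E for @idfun R})
    (alpha beta : E) : E :=
  beta - (2 * ip beta alpha / ip alpha alpha) *: alpha.

Record root_system (R : realType) (E : vectType R) (ip : {dot E for @idfun R})
    (Phi : {fset E}) : Prop := RootSystem {
  root_span : <<Phi>>%VS = fullv;
  root_neq0 : 0 \notin Phi;
  root_reduced : forall (alpha : E) (c : R),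
    alpha \in Phi -> c *: alpha \in Phi -> c = 1 \/ c = -1;
  root_reflection : forall alpha beta : E,
    alpha \in Phi -> beta \in Phi -> reflection ip alpha beta \in Phi;
  root_integral : forall alpha beta : E,
    alpha \in Phi -> beta \in Phi ->
    2 * ip beta alpha / ip alpha alpha \is a Num.int }.

(* The subgroup generated by the reflections in the roots, inside the group of
   bijections of E. *)
Inductive weyl (R : realType) (E : vectType R) (ip : {dot E for @idfun R})
    (Phi : {fset E}) : (E -> E) -> Prop :=
| weyl_id : weyl ip Phi id
| weyl_reflection (alpha : E) : alpha \in Phi -> weyl ip Phi (reflection ip alpha)
| weyl_comp (u v : E -> E) :
    weyl ip Phi u -> weyl ip Phi v -> weyl ip Phi (u \o v)
| weyl_inv (u v : E -> E) :
    weyl ip Phi u -> cancel u v -> cancel v u -> weyl ip Phi v.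

Definition is_base (R : realType) (E : vectType R) (Phi Delta : {fset E}) : Prop :=
  [/\ Delta `<=` Phi,
      basis_of fullv Delta &
      forall beta : E, beta \in Phi -> exists k : E -> nat,
        beta = \sum_(delta <- Delta) delta *+ k delta \/
        beta = - \sum_(delta <- Delta) delta *+ k delta].

(* A set of positive roots is the set of roots that are nonnegative integral
   combinations of some base. *)
Definition positive_roots (R : realType) (E : vectType R) (Phi Phip : {fset E}) :
    Prop :=
  exists2 Delta : {fset E}, is_base Phi Delta &
    forall beta : E, beta \in Phip <->
      beta \in Phi /\
      exists k : E -> nat, beta = \sum_(delta <- Delta) delta *+ k delta.

Definition closed_set (R : realType) (E : vectType R) (Phi T : {fset E}) : Prop :=
  forall alpha beta : E, alpha \in T -> beta \in T ->
    alpha + beta \in Phi -> alpha + beta \in T.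

Definition special_closed (R : realType) (E : vectType R) (Phi T : {fset E}) :
    Prop :=
  [/\ T `<=` Phi, closed_set Phi T &
      ~ exists2 alpha : E, alpha \in T & - alpha \in T].

Definition conjugate (R : realType) (E : vectType R) (ip : {dot E for @idfun R})
    (Phi T T' : {fset E}) : Prop :=
  exists2 w : E -> E, weyl ip Phi w & [fset w x | x in T] = T'.

(* M is a set of representatives of the conjugacy classes of the sets
   satisfying P, with exactly one representative for each class. *)
Definition representatives (R : realType) (E : vectType R)
    (ip : {dot E for @idfun R}) (Phi : {fset E}) (P : {fset E} -> Prop)
    (M : {fset {fset E}}) : Prop :=
  (forall T : {fset E}, T \in M -> P T) /\
  (forall S : {fset E}, P S ->
     exists! T : {fset E}, T \in M /\ conjugate ip Phi S T).

Definition decomposable (R : realType) (E : vectType R) (T : {fset E}) : {fset E} :=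
  [fset gamma in T | `[< exists alpha beta : E,
     [/\ alpha \in T, beta \in T & gamma = alpha + beta] >]].

Definition stabilizer (R : realType) (E : vectType R) (ip : {dot E for @idfun R})
    (Phi T : {fset E}) (w : E -> E) : Prop :=
  weyl ip Phi w /\ [fset w x | x in T] = T.

(* The orbit of alpha \in T under the stabilizer of T; it is contained in T, so
   cutting it out of T loses nothing. *)
Definition stab_orbit (R : realType) (E : vectType R) (ip : {dot E for @idfun R})
    (Phi T : {fset E}) (alpha : E) : {fset E} :=
  [fset beta in T | `[< exists2 w : E -> E,
     stabilizer ip Phi T w & beta = w alpha >]].

Definition stab_orbits (R : realType) (E : vectType R) (ip : {dot E for @idfun R})
    (Phi T : {fset E}) : {fset {fset E}} :=
  [fset stab_orbit ip Phi T alpha | alpha in T `\` decomposable T].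

(* s lists one representative of each orbit, in some order of the orbits. *)
Definition orbit_choice (R : realType) (E : vectType R) (ip : {dot E for @idfun R})
    (Phi T : {fset E}) (s : seq E) : Prop :=
  exists2 Os : seq {fset E}, perm_eq Os (stab_orbits ip Phi T) &
    all2 (fun (alpha : E) (O : {fset E}) => alpha \in O) s Os.

Definition add_if_new (R : realType) (E : vectType R) (ip : {dot E for @idfun R})
    (Phi : {fset E}) (L : {fset {fset E}}) (S : {fset E}) : {fset {fset E}} :=
  if `[< exists2 S' : {fset E}, S' \in L & conjugate ip Phi S S' >]
  then L else S |` L.

(* The two nested loops, over an enumeration Ms of M and, for each T, a list
   choice T of orbit representatives. *)
Definition algorithm (R : realType) (E : vectType R) (ip : {dot E for @idfun R})
    (Phi : {fset E}) (Ms : seq {fset E}) (choice : {fset E} -> seq E) :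
    {fset {fset E}} :=
  foldl (fun (L : {fset {fset E}}) (T : {fset E}) =>
           foldl (fun (L' : {fset {fset E}}) (alpha : E) =>
                    add_if_new ip Phi L' (T `\ alpha))
                 L (choice T))
        fset0 Ms.

(* L is a possible output on input M: the order in which M and the orbits are
   visited and the choice of the orbit representatives are left free. *)
Definition output (R : realType) (E : vectType R) (ip : {dot E for @idfun R})
    (Phi : {fset E}) (M L : {fset {fset E}}) : Prop :=
  exists (Ms : seq {fset E}) (choice : {fset E} -> seq E),
    [/\ perm_eq Ms M,
        forall T : {fset E}, T \in M -> orbit_choice ip Phi T (choice T) &
        L = algorithm ip Phi Ms choice].

(* L k is the family obtained for cardinality k, for k = m, m - 1, ..., 1 with
   m = #|` Phip|; the values of L outside this range are irrelevant. *)
Definition iteration (R : realType) (E : vectType R) (ip : {dot E for @idfun R})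
    (Phi Phip : {fset E}) (L : nat -> {fset {fset E}}) : Prop :=
  L #|` Phip| = [fset Phip] /\
  forall k : nat, (0 < k < #|` Phip|)%N -> output ip Phi (L k.+1) (L k).

(* Main.v *)
Require Import Defs.
From mathcomp Require Import all_boot all_order all_algebra finmap.
From mathcomp Require Import boolp reals.
From mathcomp Require Import ring lra zify.

Set Implicit Arguments.
Unset Strict Implicit.
Unset Printing Implicit Defensive.

Import Order.TTheory GRing.Theory Num.Theory.

Local Open Scope fset_scope.
Local Open Scope ring_scope.

(** A root can be removed from a special closed set T without losing closedness
exactly when it is not a sum of two roots of T, and the Weyl group carries such
roots of T to such roots of its images. So removing one representative of each
orbit from one representative T of each class reaches every class of sets
[T `\ a] that are again closed. The theorem then amounts to two facts about a
special closed set S and a set P of positive roots.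

If #|S| < #|P|, then S is obtained from a special closed set by removing one
root ([special_card_extend]). Let [weight S x] be the inner product of x with
the sum of S. It is positive on S ([weight_gt0]): for b in S, the reflection in
b negates the inner product with b, so the roots of S that it keeps in S cancel
out, and every other root of S, b among them, makes a positive contribution
([special_reflection]). Let c be a root of maximal weight among those outside
both S and -S. If b is in S and c + b is a root, then c + b is not in -S, as
otherwise -c = -(c + b) + b would be in S; since c + b is heavier than c, it has
to be in S. Hence S together with c is closed.

Two special closed sets P and S that contain a root from each pair of opposite
roots are conjugate ([positive_conj]). If they differ, let a be a root of
minimal [weight P] in P outside S. In a decomposition of a, the summands would
be lighter than a, hence in S, and so would be a. As a is indecomposable, the
reflection in a maps P to P with a replaced by -a ([positive_reflection]), which
has one more root in common with S. By counting, the special closed sets of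
maximal cardinality are of this kind, so all of them are conjugate to P; this
starts the iteration. *)

(** * Finite sets and lists *)

Lemma fset_argmax (R : realType) (K : choiceType) (A : {fset K}) (f : K -> R) a :
  a \in A ->
  exists2 c, c \in A & forall d, d \in A -> f d <= f c.
Proof.
move=> aA.
case: (@arg_maxP _ _ A [` aA] predT (fun i => f (val i))) => // i _ max_i.
exists (val i); first exact: valP.
by move=> d dA; exact: (max_i [` dA]).
Qed.

Lemma imfset_cancel (K : choiceType) (w v : K -> K) (T : {fset K}) :
  cancel w v -> [fset v x | x in [fset w x | x in T]] = T.
Proof.
move=> wK; rewrite -imfset_comp -[RHS]imfset_id.
by apply: eq_imfset => // x; exact: wK.
Qed.

(** Both directions are needed: a chosen representative lies in some orbit, and
each orbit has a chosen representative. *)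
Lemma all2_exists (A B : eqType) (r : A -> B -> bool) (s : seq A) (t : seq B) :
  all2 r s t ->
  (forall x : A, x \in s -> exists2 y, y \in t & r x y) /\
  (forall y, y \in t -> exists2 x, x \in s & r x y).
Proof.
elim: s t => [|x s IH] [|y t]//= /andP[rxy /IH[st ts]]; split=> z.
  rewrite inE => /predU1P[->|/st[u ut rzu]]; first by exists y; rewrite ?mem_head.
  by exists u; rewrite // inE ut orbT.
rewrite inE => /predU1P[->|/ts[u us ruz]]; first by exists x; rewrite ?mem_head.
by exists u; rewrite // inE us orbT.
Qed.

(** * Roots and strings of roots *)

Section RootSystem.
Variables (R : realType) (E : vectType R) (ip : {dot E for @idfun R}).
Variables (Phi : {fset E}) (root_Phi : root_system ip Phi).
Implicit Types (a b c x : E) (S T P : {fset E}).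

Lemma ipC a b : ip a b = ip b a.
Proof. by rewrite hermC expr0 mul1r. Qed.

Lemma ip_gt0 a : a \in Phi -> 0 < ip a a.
Proof.
move=> aPhi; apply: neq0_dnorm_gt0; apply: contraTneq aPhi => ->.
exact: root_neq0 root_Phi.
Qed.

Lemma root_nz a : a \in Phi -> a != 0.
Proof. by move=> /ip_gt0; apply: contraTneq => ->; rewrite linear0l ltxx. Qed.

Definition cartan a b : R := 2 * ip a b / ip b b.

Lemma reflectionE a b : reflection ip a b = b - cartan b a *: a.
Proof. by []. Qed.

Lemma reflection_self a : a \in Phi -> reflection ip a a = - a.
Proof.
move=> /ip_gt0 a_gt0; rewrite reflectionE /cartan mulfK ?gt_eqF//.
by rewrite scaler_nat mulr2n opprD addrA subrr add0r.
Qed.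

Lemma rootN a : a \in Phi -> - a \in Phi.
Proof.
by move=> aPhi; rewrite -reflection_self//; exact: (root_reflection root_Phi).
Qed.

Lemma root_double a : a \in Phi -> a + a \notin Phi.
Proof.
move=> aPhi; apply/negP; rewrite -mulr2n -scaler_nat.
by move=> /(root_reduced root_Phi aPhi)[]; lra.
Qed.

Lemma cartan_int a b : a \in Phi -> b \in Phi -> exists k : int, cartan a b = k%:~R.
Proof. by move=> aPhi bPhi; apply/intrP/(root_integral root_Phi). Qed.

(** By the strict Cauchy-Schwarz inequality the two positive integers [cartan a b]
and [cartan b a] have product less than 4, so one of them is 1, and the
corresponding reflection yields a - b or its opposite. *)
Lemma root_sub a b : a \in Phi -> b \in Phi -> a != b -> 0 < ip a b ->
  a - b \in Phi.
Proof.
move=> aPhi bPhi aDb ab_gt0.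
have a_gt0 := ip_gt0 aPhi; have b_gt0 := ip_gt0 bPhi.
have cs : ip a b ^+ 2 < ip a a * ip b b.
  set x := a - (ip a b / ip b b) *: b.
  have x_nz : x != 0.
    apply/eqP => /subr0_eq aE; move: (aPhi); rewrite aE.
    case/(root_reduced root_Phi bPhi) => cE.
      by move/eqP: aDb; apply; rewrite aE cE scale1r.
    have : 0 < ip a b / ip b b by rewrite divr_gt0.
    by rewrite cE; lra.
  have : 0 < ip x x by exact: neq0_dnorm_gt0.
  rewrite /x linearBl !linearBr /= !linearZl_LR !linearZr /= (ipC b a).
  rewrite [X in 0 < X](_ : _ = ip a a - ip a b ^+ 2 / ip b b); last first.
    by field; rewrite gt_eqF.
  by rewrite subr_gt0 ltr_pdivrMr.
have [k kE] := cartan_int aPhi bPhi; have [l lE] := cartan_int bPhi aPhi.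
have kl_lt4 : k%:~R * l%:~R < 4 :> R.
  rewrite -kE -lE /cartan (ipC b a) mulrACA -invfM ltr_pdivrMr ?mulr_gt0//.
  rewrite (_ : 2 * _ * _ = 4 * ip a b ^+ 2); last by ring.
  by rewrite (mulrC (ip b b)) ltr_pM2l.
have k_gt0 : 0 < k%:~R :> R by rewrite -kE /cartan divr_gt0// mulr_gt0.
have l_gt0 : 0 < l%:~R :> R by rewrite -lE /cartan divr_gt0// mulr_gt0// ipC.
have : k = 1 \/ l = 1.
  move: k_gt0 l_gt0 kl_lt4; rewrite -intrM !ltr0z -[4]/(4%:~R) ltr_int; nia.
case=> [k1|l1].
  have := root_reflection root_Phi bPhi aPhi.
  by rewrite reflectionE kE k1 scale1r.
have := root_reflection root_Phi aPhi bPhi.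
by rewrite reflectionE lE l1 scale1r => /rootN; rewrite opprB.
Qed.

Lemma reflectionK a : a \in Phi -> involutive (reflection ip a).
Proof.
move=> /ip_gt0 a_gt0 b; rewrite [LHS]reflectionE.
have -> : cartan (reflection ip a b) a = - cartan b a.
  by rewrite reflectionE /cartan linearBl linearZl_LR /=; field; rewrite gt_eqF.
by rewrite reflectionE scaleNr opprK subrK.
Qed.

Lemma reflectionD a : {morph reflection ip a : b c / b + c}.
Proof.
move=> b c; rewrite !reflectionE /cartan linearDl /= mulrDr mulrDl scalerDl.
by rewrite opprD addrACA.
Qed.

Lemma ip_reflection a b : a \in Phi -> ip a (reflection ip a b) = - ip a b.
Proof.
move=> /ip_gt0 a_gt0; rewrite reflectionE linearBr linearZr /= /cartan (ipC b).
by field; rewrite gt_eqF.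
Qed.

Lemma cartan_subMn a b j : a \in Phi -> cartan (b - a *+ j) a = cartan b a - (2 * j)%:R.
Proof.
move=> /ip_gt0 a_gt0; rewrite /cartan linearBl linearMnl /= -mulr_natr natrM.
by field; rewrite gt_eqF.
Qed.

Lemma cartan_gt0 a b : a \in Phi -> (0 < cartan b a) = (0 < ip b a).
Proof.
by move=> /ip_gt0 a_gt0; rewrite /cartan ltr_pdivlMr// mul0r pmulr_rgt0.
Qed.

(** Strings of roots are unbroken. Up to the middle of the string the inner product
with a stays positive, so [root_sub] applies at each step; the reflection in a
reverses the string and gives the other half. *)
Lemma root_string a b k j : a \in Phi -> b \in Phi -> b != a ->
  cartan b a = k%:R -> (j <= k)%N -> b - a *+ j \in Phi.
Proof.
move=> aPhi bPhi bDa kE.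
(* The step from i to i + 1 is possible as long as 2 i < k, hence the bound. *)
have half i : (i.*2 <= k.+1)%N -> b - a *+ i \in Phi.
  elim: i => [|i IH] le_ik; first by rewrite mulr0n subr0.
  have {}IH := IH ltac:(lia).
  rewrite mulrSr opprD addrA root_sub//; last first.
    by rewrite -cartan_gt0// cartan_subMn// kE subr_gt0 ltr_nat; lia.
  apply: contra_neq bDa => /eqP; rewrite subr_eq -mulrS => /eqP bE.
  move: bPhi; rewrite bE -scaler_nat => /(root_reduced root_Phi aPhi)[/eqP|].
    by rewrite pnatr_eq1 => /eqP ->; rewrite scale1r.
  by move=> iE; exfalso; have := ler0n R i.+1; rewrite iE; lra.
move=> le_jk; have [|lt_kj] := leqP j.*2 k.+1; first exact: half.
have /(root_reflection root_Phi aPhi) := half (k - j)%N ltac:(lia).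
rewrite reflectionE cartan_subMn// kE -natrB; last by lia.
rewrite scaler_nat -addrA -opprD -mulrnDr.
by rewrite (_ : _ + _ = j)%N //; lia.
Qed.

(** * Extension of special closed sets *)

Lemma special_sub S : special_closed Phi S -> {subset S <= Phi}.
Proof. by case=> /fsubsetP. Qed.

Lemma special_notN S a : special_closed Phi S -> a \in S -> - a \notin S.
Proof. by case=> _ _ nS aS; apply/negP => NaS; apply: nS; exists a. Qed.

(** The string from b to its reflection consists of the roots b + j a, and
closedness carries membership in S along it. *)
Lemma special_reflection S a b : special_closed Phi S -> a \in S -> b \in S ->
  ip b a <= 0 -> reflection ip a b \in S.
Proof.
move=> sS aS bS ba_le0; have SPhi := special_sub sS.
have aPhi := SPhi a aS; have bPhi := SPhi b bS; have a_gt0 := ip_gt0 aPhi.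
have [k kE] : exists k : nat, cartan b (- a) = k%:R.
  have [z zE] := cartan_int bPhi (rootN aPhi).
  suff : 0 <= z by case: z zE => // k; exists k.
  rewrite -(ler0z R) -zE /cartan !linearNr/= linearNl/= opprK.
  by rewrite divr_ge0 ?(ltW a_gt0)// mulr_ge0// oppr_ge0.
have cba : cartan b a = - k%:R.
  rewrite -kE /cartan !linearNr/= linearNl/= opprK.
  by rewrite mulrN mulNr opprK.
rewrite reflectionE cba scaleNr opprK scaler_nat.
have bDNa : b != - a.
  by apply: contraTneq bS => ->; exact: special_notN sS aS.
suff : forall j, (j <= k)%N -> b + a *+ j \in S by apply.
elim=> [|j IH] le_jk; first by rewrite mulr0n addr0.
case: sS => _ clS _; rewrite mulrSr addrA; apply: clS => //.
  by apply: IH; lia.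
have := root_string (rootN aPhi) bPhi bDNa kE le_jk.
by rewrite mulNrn opprK mulrSr addrA.
Qed.

(** A linear form that is positive on S ([weight_gt0]); it plays the role that the
height with respect to a base has for positive roots. *)
Definition weight S x : R := \sum_(c <- S) ip x c.

Lemma weightD S x y : weight S (x + y) = weight S x + weight S y.
Proof. by rewrite /weight -big_split; apply: eq_bigr => c _; rewrite linearDl. Qed.

(** The reflection s in b negates the inner product with b, so the roots c of S with
s c in S contribute 0 altogether. By [special_reflection] a root c of S with s c
outside S has positive inner product with b, and b is such a root. *)
Lemma weight_gt0 S b : special_closed Phi S -> b \in S -> 0 < weight S b.
Proof.
move=> sS bS; have bPhi := special_sub sS bS.
pose s := reflection ip b; have sK : involutive s by exact: reflectionK.
rewrite /weight (bigID (fun c => s c \in S)) /=.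
rewrite [X in X + _](_ : _ = 0) ?add0r.
  have contrib c : c \in S -> s c \notin S -> 0 < ip b c.
    move=> cS; rewrite ltNge; apply: contra => bc_le0.
    by apply: special_reflection; rewrite // ipC.
  rewrite big_mkcond (big_fsetD1 b)//= /s reflection_self// special_notN//=.
  rewrite ltr_pwDl ?ip_gt0// big_seq sumr_ge0// => c /fsetD1P[_ cS].
  by case: ifP => // /(contrib _ cS)/ltW.
rewrite -big_filter; set A := [seq _ <- _ | _].
have sA : perm_eq A (map s A).
  rewrite uniq_perm ?filter_uniq ?fset_uniq//.
    by rewrite (map_inj_uniq (can_inj sK)) filter_uniq ?fset_uniq.
  move=> c; apply/idP/mapP => [|[d + ->]]; rewrite !mem_filter.
    move=> /andP[scS cS]; exists (s c); rewrite ?sK//.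
    by rewrite mem_filter sK cS.
  by move=> /andP[sdS dS]; rewrite sK dS.
suff : \sum_(c <- A) ip b c = - \sum_(c <- A) ip b c by lra.
rewrite {1}(perm_big _ sA) big_map -sumrN; apply: eq_bigr => c _.
by rewrite ip_reflection.
Qed.

(** The root added is one of maximal weight among the roots outside S and -S. *)
Lemma special_extend S a : special_closed Phi S ->
  a \in Phi -> a \notin S -> - a \notin S ->
  exists2 c, c \notin S & special_closed Phi (c |` S).
Proof.
move=> sS aPhi aS NaS.
pose C := [fset x in Phi | (x \notin S) && (- x \notin S)].
have inC x : (x \in C) = [&& x \in Phi, x \notin S & - x \notin S].
  by rewrite !inE /=.
have aC : a \in C by rewrite inC aPhi aS.
have [c + max_c] := fset_argmax (weight S) aC.
rewrite inC => /and3P[cPhi cS NcS]; exists c => //.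
have c_add b : b \in S -> c + b \in Phi -> c + b \in S.
  move=> bS cbPhi; apply/negPn/negP => cbS.
  case: (boolP (- (c + b) \in S)) => [NcbS|NcbS].
    case/negP: NcS; have [_ clS _] := sS.
    have := clS _ _ NcbS bS; rewrite opprD addrNK; apply; exact: rootN.
  have : c + b \in C by rewrite inC cbPhi cbS.
  by move=> /max_c; rewrite weightD; have := weight_gt0 sS bS; lra.
split.
- apply/fsubsetP => x /fset1UP[->//|]; exact: special_sub.
- move=> x y /fset1UP[->|xS] /fset1UP[->|yS] xyPhi; apply/fset1UP; right.
  + by move: (root_double cPhi); rewrite xyPhi.
  + exact: c_add.
  + by rewrite addrC; apply: c_add => //; rewrite addrC.
  + by case: sS => _ clS _; exact: clS.
- case=> x /fset1UP[->|xS] /fset1UP[NxE|NxS].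
  + by move: (ip_gt0 cPhi); rewrite -{1}NxE linearNl /=; have := ip_gt0 cPhi; lra.
  + by rewrite NxS in NcS.
  + by move: NcS; rewrite -NxE opprK xS.
  + by move: (special_notN sS xS); rewrite NxS.
Qed.

(** * Positive systems *)

(** Positivity expressed without a base: a special closed set with as many roots as
a set of positive roots has this property by counting ([special_card_max]). *)
Definition positive_system P :=
  special_closed Phi P /\ forall a, a \in Phi -> a \in P \/ - a \in P.

Lemma decomposableP T c :
  reflect (c \in T /\ exists a b, [/\ a \in T, b \in T & c = a + b])
          (c \in decomposable T).
Proof. by rewrite !inE; apply: (iffP andP) => -[cT /asboolP]. Qed.

(** If b has positive inner product with a, walk down the string b - j a: a first
exit from P at j + 1 would put (j + 1) a - b in P, and then
a = (b - j a) + ((j + 1) a - b) would be decomposable. *)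
Lemma positive_reflection P a b : positive_system P -> a \in P ->
  a \notin decomposable P -> b \in P -> b != a -> reflection ip a b \in P.
Proof.
move=> [sP totP] aP a_ind bP bDa; have PPhi := special_sub sP.
have [aPhi bPhi] := (PPhi _ aP, PPhi _ bP).
have [ba_le0|ba_gt0] := leP (ip b a) 0; first exact: special_reflection.
have [k kE] : exists k : nat, cartan b a = k%:R.
  have [z zE] := cartan_int bPhi aPhi.
  suff : 0 < z by case: z zE => // k; exists k.
  by rewrite -(ltr0z R) -zE cartan_gt0.
rewrite reflectionE kE scaler_nat.
suff : forall j, (j <= k)%N -> b - a *+ j \in P by apply.
elim=> [|j IH] le_jk; first by rewrite mulr0n subr0.
have [//|NP] := totP _ (root_string aPhi bPhi bDa kE le_jk).
case/negP: a_ind; apply/decomposableP; split=> //.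
exists (b - a *+ j), (- (b - a *+ j.+1)); split=> //; first by apply: IH; lia.
by rewrite opprB addrC addrA subrK mulrS addrK.
Qed.

(** * Action of the Weyl group *)

(** Stability of Phi is an equivalence because the case of an inverse uses the
converse implication. *)
Lemma weyl_automorphism w : weyl ip Phi w ->
  exists v, [/\ weyl ip Phi v, cancel w v, cancel v w,
                {morph w : x y / x + y} & forall x, (w x \in Phi) = (x \in Phi)].
Proof.
elim=> {w} [|a aPhi|u v Wu [u' [Wu' uK u'K uD uPhi]] Wv [v' [Wv' vK v'K vD vPhi]]
           |u v Wu [u' [Wu' uK u'K uD uPhi]] uvK vuK].
- by exists id; split=> //; exact: weyl_id.
- exists (reflection ip a); split.
  + exact: weyl_reflection.
  + exact: reflectionK.
  + exact: reflectionK.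
  + exact: reflectionD.
  + move=> x; apply/idP/idP; last exact: (root_reflection root_Phi aPhi).
    by move=> /(root_reflection root_Phi aPhi); rewrite reflectionK.
- exists (v' \o u'); split.
  + exact: weyl_comp.
  + exact: can_comp.
  + exact: can_comp.
  + by move=> x y /=; rewrite vD uD.
  + by move=> x /=; rewrite uPhi vPhi.
- exists u; split=> // [x y|x]; last by rewrite -uPhi vuK.
  by apply: (can_inj uvK); rewrite uD !vuK.
Qed.

Lemma weyl_inj w : weyl ip Phi w -> injective w.
Proof. by move=> /weyl_automorphism[v [_ /can_inj]]. Qed.

Lemma weylN w x : weyl ip Phi w -> w (- x) = - w x.
Proof.
move=> /weyl_automorphism[v [_ _ _ wD _]].
have w0 : w 0 = 0 by apply: (addrI (w 0)); rewrite -wD !addr0.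
by apply/eqP; rewrite -addr_eq0 -wD addNr w0.
Qed.

Lemma mem_weyl w T x : weyl ip Phi w -> (w x \in [fset w y | y in T]) = (x \in T).
Proof. by move=> /weyl_inj w_inj; rewrite mem_imfset. Qed.

Lemma weyl_special w T : weyl ip Phi w -> special_closed Phi T ->
  special_closed Phi [fset w x | x in T].
Proof.
move=> Ww [/fsubsetP TPhi clT nT].
have [v [_ _ _ wD wPhi]] := weyl_automorphism Ww.
split.
- by apply/fsubsetP => _ /imfsetP[x /= xT ->]; rewrite wPhi TPhi.
- move=> _ _ /imfsetP[x /= xT ->] /imfsetP[y /= yT ->].
  by rewrite -wD wPhi mem_weyl// => /clT; exact.
- case=> _ /imfsetP[x /= xT ->]; rewrite -weylN// mem_weyl// => NxT.
  by apply: nT; exists x.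
Qed.

Lemma weyl_positive w P : weyl ip Phi w -> positive_system P ->
  positive_system [fset w x | x in P].
Proof.
move=> Ww [sP totP]; split; first exact: weyl_special.
move=> x; have [v [_ wK vK wD wPhi]] := weyl_automorphism Ww.
by rewrite -(vK x) wPhi -weylN// !mem_weyl//; exact: totP.
Qed.

Lemma conj_refl T : conjugate ip Phi T T.
Proof. by exists id; [exact: weyl_id | exact: imfset_id]. Qed.

Lemma conj_sym T T' : conjugate ip Phi T T' -> conjugate ip Phi T' T.
Proof.
case=> w Ww <-; have [v [Wv wK _ _ _]] := weyl_automorphism Ww.
by exists v => //; rewrite imfset_cancel.
Qed.

Lemma conj_trans T T' T'' : conjugate ip Phi T T' ->
  conjugate ip Phi T' T'' -> conjugate ip Phi T T''.
Proof.
case=> w Ww <- [v Wv <-]; exists (v \o w); first exact: weyl_comp.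
by rewrite -imfset_comp.
Qed.

Lemma conj_card T T' : conjugate ip Phi T T' -> #|` T'| = #|` T|.
Proof. by case=> w /weyl_inj w_inj <-; rewrite card_imfset. Qed.

(** * Conjugacy and cardinality of positive systems *)

(** Induction on the number of roots of S outside P. The reflection in an
indecomposable root a of P outside S lowers it: no root of S leaves P, and -a
enters. *)
Lemma positive_conj P S : positive_system P -> positive_system S ->
  conjugate ip Phi P S.
Proof.
move=> + posS; have [sS totS] := posS.
have [n le_n] := ubnP #|` S `\` P|; elim: n => // n IH in P le_n *.
move=> posP; have [sP totP] := posP; have PPhi := special_sub sP.
have [PS|/fsubsetPn[x0 x0P x0S]] := boolP (P `<=` S).
  suff -> : P = S by exact: conj_refl.
  apply/eqP; rewrite eqEfsubset PS /=; apply/fsubsetP => x xS.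
  have [//|/(fsubsetP PS)] := totP x (special_sub sS xS).
  by move/negP: (special_notN sS xS).
(* A decomposable element of P is heavier than its two summands, so a lightest
   element of P outside S is indecomposable: lighter summands would be in S. *)
have x0C : x0 \in P `\` S by rewrite inE x0S.
have [a /fsetDP[aP aS] min_a] := fset_argmax (fun x => - weight P x) x0C.
have aPhi := PPhi a aP.
have a_ind : a \notin decomposable P.
  apply/negP => /decomposableP[_ [b [c [bP cP aE]]]].
  have [wb wc] := (weight_gt0 sP bP, weight_gt0 sP cP).
  have lighter d : d \in P -> weight P d < weight P a -> d \in S.
    move=> dP; rewrite ltNge; apply: contraNT => dS.
    by rewrite -lerN2 min_a// inE dS.
  case/negP: aS; rewrite aE; have [_ clS _] := sS.
  rewrite aE weightD in lighter.
  by apply: clS; rewrite -?aE//; apply: lighter => //; lra.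
have Ws := weyl_reflection ip aPhi; set s := reflection ip a in Ws.
apply: conj_trans (IH [fset s x | x in P] _ (weyl_positive Ws posP)).
  by exists s.
have NaS : - a \in S by have [|//] := totS a aPhi; rewrite (negPf aS).
suff : (S `\` [fset s x | x in P] `<` S `\` P)%fset.
  by move=> /fproper_ltn_card; lia.
rewrite fproperE; apply/andP; split; last first.
  apply/fsubsetPn; exists (- a); first by rewrite inE special_notN.
  by rewrite inE -(reflection_self aPhi) mem_weyl// aP.
apply/fsubsetP => y /fsetDP[yS ysP]; rewrite inE yS andbT; apply: contra ysP => yP.
rewrite -(reflectionK aPhi y) mem_weyl// positive_reflection//.
by apply: contraNneq aS => <-.
Qed.

(** Special sets are disjoint from their opposites. This is what bounds their
cardinality by half that of Phi. *)
Lemma card_opp_union S : special_closed Phi S ->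
  #|` S `|` [fset - x | x in S]| = (#|` S|).*2.
Proof.
move=> sS; rewrite cardfsU (_ : _ `&` _ = fset0).
  by rewrite cardfs0 subn0 card_imfset ?addnn//; exact: oppr_inj.
apply/fsetP => x; rewrite !inE; apply/negP => /andP[xS /imfsetP[y /= yS xE]].
by move: (special_notN sS yS); rewrite -xE xS.
Qed.

Lemma opp_union_sub S : special_closed Phi S -> S `|` [fset - x | x in S] `<=` Phi.
Proof.
move=> /special_sub SPhi; apply/fsubsetP => x /fsetUP[/SPhi//|].
by case/imfsetP=> y /= /SPhi /rootN + ->.
Qed.

Lemma positive_card P : positive_system P -> #|` Phi| = (#|` P|).*2.
Proof.
move=> [sP totP]; rewrite -card_opp_union//.
suff -> : P `|` [fset - x | x in P] = Phi by [].
apply/eqP; rewrite eqEfsubset opp_union_sub//; apply/fsubsetP => x xPhi.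
apply/fsetUP; have [->|NxP] := totP x xPhi; [by left | right].
by apply/imfsetP; exists (- x); rewrite ?opprK.
Qed.

Lemma special_card_le S P : positive_system P -> special_closed Phi S ->
  (#|` S| <= #|` P|)%N.
Proof.
move=> posP sS; rewrite -leq_double -(positive_card posP) -card_opp_union//.
exact/fsubset_leq_card/opp_union_sub.
Qed.

Lemma special_card_max S P : positive_system P -> special_closed Phi S ->
  #|` S| = #|` P| -> positive_system S.
Proof.
move=> posP sS cardS; split=> // a aPhi.
have : a \in S `|` [fset - x | x in S].
  suff -> : S `|` [fset - x | x in S] = Phi by [].
  apply/eqP; rewrite eqEfcard opp_union_sub//= card_opp_union//.
  by rewrite (positive_card posP) cardS.
move=> /fsetUP[|/imfsetP[x /= xS ->]]; first by left.
by right; rewrite opprK.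
Qed.

Lemma special_card_extend S P : positive_system P -> special_closed Phi S ->
  (#|` S| < #|` P|)%N -> exists2 c, c \notin S & special_closed Phi (c |` S).
Proof.
move=> posP sS ltSP.
have [] : exists2 a, a \in Phi & a \notin S `|` [fset - x | x in S].
  apply/fsubsetPn; apply: contraTN ltSP => /fsubset_leq_card.
  by rewrite (positive_card posP) card_opp_union// leq_double leqNgt.
move=> a aPhi; rewrite in_fsetU negb_or => /andP[aS aNS].
apply: (special_extend sS aPhi aS); apply: contra aNS => NaS.
by apply/imfsetP; exists (- a); rewrite ?opprK.
Qed.

(** Linear independence of the base forbids a root and its opposite from both being
nonnegative combinations of it. *)
Lemma positive_roots_system P : positive_roots Phi P -> positive_system P.
Proof.
case=> Delta [/fsubsetP DPhi bD nn] memP.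
have indep k : \sum_(d <- Delta) d *+ k d = 0 -> forall d, d \in Delta -> k d = 0%N.
  move=> sum0 d dD.
  have /freeP frD : free (in_tuple Delta) by exact: basis_free bD.
  have iP : (index d Delta < size Delta)%N by rewrite index_mem.
  have := frD (fun i : 'I_(size Delta) => (k (Delta`_i))%:R) _ (Ordinal iP).
  rewrite /= nth_index// => /(_ _)/eqP; rewrite pnatr_eq0 => /(_ _)/eqP; apply.
  rewrite -[RHS]sum0 (big_nth 0) big_mkord.
  by apply: eq_bigr => i _; rewrite scaler_nat.
have combD k l : \sum_(d <- Delta) d *+ (k d + l d) =
    \sum_(d <- Delta) d *+ k d + \sum_(d <- Delta) d *+ l d.
  by rewrite -big_split; apply: eq_bigr => d _; rewrite mulrnDr.
split; last first.
  move=> a aPhi; have [k [aE|aE]] := nn a aPhi; [left|right]; apply/memP.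
    by split=> //; exists k.
  by split; [exact: rootN | exists k; rewrite aE opprK].
split.
- by apply/fsubsetP => x /memP[].
- move=> a b /memP[_ [k aE]] /memP[_ [l bE]] abPhi; apply/memP; split=> //.
  by exists (fun d => k d + l d)%N; rewrite combD aE bE.
- case=> a /memP[aPhi [k aE]] /memP[_ [l NaE]].
  have /indep kl0 : \sum_(d <- Delta) d *+ (k d + l d) = 0.
    by rewrite combD -aE -NaE subrr.
  have /negP := root_nz aPhi; apply; rewrite aE big_seq big1// => d dD.
  by have /eqP := kl0 d dD; rewrite addn_eq0 => /andP[/eqP -> _].
Qed.

(** * Removal of indecomposable roots *)

Definition special_card n T := special_closed Phi T /\ #|` T| = n.

Lemma weyl_fsetD1 w T a : weyl ip Phi w ->
  [fset w x | x in T `\ a] = [fset w x | x in T] `\ w a.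
Proof.
move=> Ww; have [v [_ _ vK _ _]] := weyl_automorphism Ww.
apply/fsetP => x; rewrite -(vK x) mem_weyl// !in_fsetD1 mem_weyl//.
by rewrite (inj_eq (weyl_inj Ww)).
Qed.

Lemma weyl_decomposable w T a : weyl ip Phi w -> a \in decomposable T ->
  w a \in decomposable [fset w x | x in T].
Proof.
move=> Ww; have [_ [_ _ _ wD _]] := weyl_automorphism Ww.
move=> /decomposableP[aT [b [c [bT cT aE]]]]; apply/decomposableP.
by split; [rewrite mem_weyl | exists (w b), (w c); rewrite aE wD !mem_weyl].
Qed.

Lemma special_fsetD1 T a : special_closed Phi T -> a \in T ->
  a \notin decomposable T -> special_closed Phi (T `\ a).
Proof.
move=> [/fsubsetP TPhi clT nT] aT a_ind; split.
- by apply/fsubsetP => x /fsetD1P[_ /TPhi].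
- move=> b c /fsetD1P[_ bT] /fsetD1P[_ cT] bcPhi.
  rewrite in_fsetD1 clT// andbT; apply: contra a_ind => /eqP <-.
  by apply/decomposableP; split; [exact: clT | exists b, c].
- by case=> x /fsetD1P[_ xT] /fsetD1P[_ NxT]; apply: nT; exists x.
Qed.

(** As roots are nonzero, the two summands would be distinct from c, hence in S,
which is closed and does not contain c. *)
Lemma indecomposable_fsetU1 S c : special_closed Phi S -> c \notin S ->
  special_closed Phi (c |` S) -> c \notin decomposable (c |` S).
Proof.
move=> [_ clS _] cS sT; have TPhi := special_sub sT.
have T_nz x : x \in c |` S -> x != 0 by move=> /TPhi/root_nz.
have cPhi := TPhi c (fset1U1 c S).
apply/negP => /decomposableP[_ [a [b [aT bT cE]]]].
have aS : a \in S.
  case/fset1UP: aT => // aE; move: cE (T_nz b bT).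
  by rewrite aE -{1}[c]addr0 => /addrI <-; rewrite eqxx.
have bS : b \in S.
  case/fset1UP: bT => // bE; move: cE (T_nz a aT).
  by rewrite bE -{1}[c]add0r => /addIr <-; rewrite eqxx.
by case/negP: cS; rewrite cE clS// -cE.
Qed.

Lemma stab_orbitP T a b :
  reflect (b \in T /\ exists2 w, stabilizer ip Phi T w & b = w a)
          (b \in stab_orbit ip Phi T a).
Proof. by rewrite !inE; apply: (iffP andP) => -[bT /asboolP]. Qed.

(** The stabilizer of T preserves [decomposable T], so any member of the orbit of an
indecomposable root is indecomposable. *)
Lemma orbit_choice_indecomposable T s a : orbit_choice ip Phi T s -> a \in s ->
  a \in T /\ a \notin decomposable T.
Proof.
case=> Os permOs /all2_exists[sOs _] /sOs[O].
rewrite (perm_mem permOs) => /imfsetP[b /= /fsetDP[bT b_ind] ->].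
move=> /stab_orbitP[aT [w [Ww wT] aE]]; split=> //.
apply: contra b_ind => a_dec; have [v [Wv wK vK _ _]] := weyl_automorphism Ww.
have vT : [fset v x | x in T] = T by rewrite -[in LHS]wT imfset_cancel.
by have := weyl_decomposable Wv a_dec; rewrite vT aE wK.
Qed.

Lemma orbit_choice_conj T s b : orbit_choice ip Phi T s -> b \in T ->
  b \notin decomposable T ->
  exists2 a, a \in s & conjugate ip Phi (T `\ b) (T `\ a).
Proof.
case=> Os permOs /all2_exists[_ +] bT b_ind.
have bO : stab_orbit ip Phi T b \in Os.
  by rewrite (perm_mem permOs); apply/imfsetP; exists b; rewrite //= inE b_ind.
move=> /(_ _ bO)[a as_ /stab_orbitP[aT [w [Ww wT] aE]]].
by exists a => //; exists w => //; rewrite weyl_fsetD1// wT aE.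
Qed.

Lemma orbit_choice_exists T : exists s, orbit_choice ip Phi T s.
Proof.
(* The default value 0 of head is never used, because orbits are nonempty. *)
exists [seq head 0 (enum_fset B) | B : {fset E} <- enum_fset (stab_orbits ip Phi T)].
exists (stab_orbits ip Phi T); first exact: perm_refl.
have nonempty O : O \in enum_fset (stab_orbits ip Phi T) ->
    head 0 (enum_fset O) \in O.
  move=> /imfsetP[b /= /fsetDP[bT _] ->].
  have : b \in stab_orbit ip Phi T b.
    apply/stab_orbitP; split=> //; exists id => //; split.
      exact: weyl_id.
    exact: imfset_id.
  move: (stab_orbit _ _ _ _) => B bB.
  change (head 0 (enum_fset B) \in enum_fset B).
  have : b \in enum_fset B by [].
  by case: (enum_fset B) => // x l _; rewrite mem_head.
elim: (enum_fset _) nonempty => //= O Os IH nonempty.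
rewrite nonempty ?mem_head//= IH// => O' O'Os; apply: nonempty.
by rewrite inE O'Os orbT.
Qed.

Lemma output_exists M : exists L, output ip Phi M L.
Proof.
have [f fP] := choice orbit_choice_exists.
by exists (algorithm ip Phi M f), M, f.
Qed.

(** * Representatives computed by the algorithm *)

Local Notation add := (add_if_new ip Phi).

Lemma foldl_add_sub L0 s S : S \in foldl add L0 s -> S \in L0 \/ S \in s.
Proof.
elim: s L0 => [|T s IH] L0 /=; first by left.
move=> /IH[|Ss]; last by right; rewrite inE Ss orbT.
rewrite /add_if_new; case: asboolP => _; first by left.
by move=> /fset1UP[->|]; [right; rewrite mem_head | left].
Qed.

(** The first alternative is the form in which the property of a set already
processed survives the rest of the loop. *)
Lemma foldl_add_cover L0 s S :
  (exists2 S', S' \in L0 & conjugate ip Phi S S') \/ S \in s ->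
  exists2 S', S' \in foldl add L0 s & conjugate ip Phi S S'.
Proof.
elim: s L0 => [|T s IH] L0 /=; first by case.
move=> H; apply: IH; case: H => [[S' S'L0 SS']|].
  left; exists S' => //; rewrite /add_if_new; case: asboolP => _ //.
  by rewrite in_fset1U S'L0 orbT.
rewrite inE => /predU1P[->|]; [left | by right].
rewrite /add_if_new; case: asboolP => // _; exists T; first exact: fset1U1.
exact: conj_refl.
Qed.

Definition irredundant (L : {fset {fset E}}) := forall T T',
  T \in L -> T' \in L -> conjugate ip Phi T T' -> T = T'.

Lemma foldl_add_irredundant L0 s : irredundant L0 -> irredundant (foldl add L0 s).
Proof.
elim: s L0 => //= S s IH L0 irrL0; apply: IH.
rewrite /add_if_new; case: asboolP => // new T T'.
move=> /fset1UP[->|TL0] /fset1UP[->|T'L0] TT' //; last exact: irrL0.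
  by case: new; exists T'.
by case: new; exists T => //; exact: conj_sym.
Qed.

Lemma algorithmE Ms ch :
  algorithm ip Phi Ms ch = foldl add fset0 [seq T `\ a | T <- Ms, a <- ch T].
Proof.
rewrite /algorithm; elim: Ms fset0 => //= T Ms IH L0; rewrite foldl_cat IH.
by congr foldl; elim: (ch T) L0 => //= a s IHs L0.
Qed.

Lemma representativesI (Q : {fset E} -> Prop) (L : {fset {fset E}}) :
  (forall T, T \in L -> Q T) ->
  (forall S, Q S -> exists2 T, T \in L & conjugate ip Phi S T) ->
  irredundant L -> representatives ip Phi Q L.
Proof.
move=> LQ cover irr; split=> // S /cover[T TL ST]; exists T; split=> //.
move=> T' [T'L ST']; apply: irr => //.
exact: conj_trans (conj_sym ST) ST'.
Qed.

Lemma representatives_cover (Q : {fset E} -> Prop) (L : {fset {fset E}}) S :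
  representatives ip Phi Q L -> Q S ->
  exists2 T, T \in L & conjugate ip Phi S T.
Proof. by move=> [_ /[apply]] [T [[TL ST] _]]; exists T. Qed.

Lemma representatives_irredundant (Q : {fset E} -> Prop) (L : {fset {fset E}}) :
  representatives ip Phi Q L -> irredundant L.
Proof.
move=> [LQ uniqL] T T' TL T'L TT'; have [T0 [_ T0_uniq]] := uniqL T (LQ T TL).
rewrite -(T0_uniq T') // (T0_uniq T) //; split=> //; exact: conj_refl.
Qed.

(** A special closed set S of cardinality n extends by a root c; some w maps c |` S
to a member T of M. Then w c is indecomposable in T, so removing the
representative of its orbit gives a conjugate of S. *)
Lemma output_representatives P n M L : positive_system P -> (n < #|` P|)%N ->
  representatives ip Phi (special_card n.+1) M -> output ip Phi M L ->
  representatives ip Phi (special_card n) L.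
Proof.
move=> posP lt_nP repM [Ms [ch [permM chP ->]]]; rewrite algorithmE.
have [MQ _] := repM.
apply: representativesI.
- move=> S /foldl_add_sub[//|/allpairsPdep[T [a [TMs aT ->]]]].
  have TM : T \in M by rewrite -(perm_mem permM).
  have [sT cardT] := MQ T TM.
  have [{}aT a_ind] := orbit_choice_indecomposable (chP T TM) aT.
  split; first exact: special_fsetD1.
  by move: cardT; rewrite (cardfsD1 a) aT => -[].
- move=> S [sS cardS]; rewrite -cardS in lt_nP.
  have [c cS sT] := special_card_extend posP sS lt_nP.
  have [|T TM [w Ww wT]] := representatives_cover (S := c |` S) repM.
    by split=> //; rewrite cardfsU1 cS cardS.
  have wcT : w c \in T by rewrite -wT mem_weyl// fset1U1.
  have [v [Wv wK vK _ _]] := weyl_automorphism Ww.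
  have wc_ind : w c \notin decomposable T.
    apply: contra (indecomposable_fsetU1 sS cS sT) => /(weyl_decomposable Wv).
    by rewrite wK -wT imfset_cancel.
  have [a a_ch wca] := orbit_choice_conj (chP T TM) wcT wc_ind.
  have [|S' S'L aS'] := @foldl_add_cover fset0
      [seq T `\ a | T <- Ms, a <- ch T] (T `\ a).
    right; apply/allpairsPdep; exists T, a; split=> //.
    by rewrite (perm_mem permM).
  exists S' => //; apply: conj_trans aS'; apply: conj_trans wca.
  by exists w => //; rewrite -wT -weyl_fsetD1// fsetU1K.
- exact: foldl_add_irredundant.
Qed.

Lemma iteration_exists P : exists L, iteration ip Phi P L.
Proof.
have [F FP] := choice output_exists.
exists (fun k => iter (#|` P| - k) F [fset P]); split; first by rewrite subnn.
move=> k /andP[_ lt_kP].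
rewrite (_ : #|` P| - k = (#|` P| - k.+1).+1)%N; last by lia.
exact: FP.
Qed.

(** Descending induction on k. At the top, every special closed set of the
cardinality of P is a positive system, hence conjugate to P. *)
Lemma iteration_representatives P L k : positive_system P ->
  iteration ip Phi P L -> (0 < k <= #|` P|)%N ->
  representatives ip Phi (special_card k) (L k).
Proof.
move=> posP [Lm Lstep] /andP[k_gt0 le_km].
have [i iE] : exists i, (k + i = #|` P|)%N by exists (#|` P| - k)%N; lia.
elim: i k k_gt0 le_km iE => [|i IH] k k_gt0 le_km iE.
  have -> : k = #|` P| by lia.
  rewrite Lm; apply: representativesI.
  - by move=> T; rewrite inE => /eqP ->; split=> //; case: posP.
  - move=> S [sS cardS]; exists P; first by rewrite inE.
    apply: positive_conj => //; exact: special_card_max posP sS cardS.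
  - by move=> T T'; rewrite !inE => /eqP -> /eqP ->.
have lt_km : (k < #|` P|)%N by lia.
apply: (output_representatives posP lt_km (IH k.+1 _ _ _)); try lia.
by apply: Lstep; rewrite k_gt0.
Qed.

Lemma iteration_union P L : positive_system P -> iteration ip Phi P L ->
  representatives ip Phi (fun T => special_closed Phi T /\ T <> fset0)
    (\bigcup_(k <- iota 1 #|` P|) L k).
Proof.
move=> posP itL; have repL := iteration_representatives posP itL.
have memU T : reflect (exists2 k, (0 < k <= #|` P|)%N & T \in L k)
    (T \in \bigcup_(k <- iota 1 #|` P|) L k).
  apply: (iffP (bigfcupP _ _ _ _)) => -[k].
    by rewrite andbT mem_iota add1n ltnS; exists k.
  by move=> k_range TLk; exists k; rewrite // andbT mem_iota add1n ltnS.
apply: representativesI.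
- move=> T /memU[k k_range TLk]; have [/(_ _ TLk)[sT cardT] _] := repL k k_range.
  by split=> // T0; move: k_range; rewrite -cardT T0 cardfs0.
- move=> S [sS /eqP]; rewrite -cardfs_gt0 => S_gt0.
  have S_range : (0 < #|` S| <= #|` P|)%N by rewrite S_gt0 special_card_le.
  have [|T TL ST] := representatives_cover (S := S) (repL _ S_range) => //.
  by exists T => //; apply/memU; exists #|` S|.
- move=> T T' /memU[k k_range TLk] /memU[k' k'_range T'Lk'] TT'.
  have [/(_ _ TLk)[_ cardT] _] := repL k k_range.
  have [/(_ _ T'Lk')[_ cardT'] _] := repL k' k'_range.
  have kE : k' = k by rewrite -cardT -cardT' (conj_card TT').
  rewrite kE in T'Lk'.
  exact: representatives_irredundant (repL k k_range) T T' TLk T'Lk' TT'.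
Qed.

End RootSystem.

Theorem mainTheorem1 (R : realType) (E : vectType R) (ip : {dot E for @idfun R})
    (Phi Phip : {fset E}) (m : nat)
    (root_Phi : root_system ip Phi) (pos_Phip : positive_roots Phi Phip)
    (card_Phip : #|` Phip| = m) :
  (forall (n : nat) (M : {fset {fset E}}), (n < m)%N ->
     representatives ip Phi
       (fun T : {fset E} => special_closed Phi T /\ #|` T| = n.+1) M ->
     (exists L : {fset {fset E}}, output ip Phi M L) /\
     (forall L : {fset {fset E}}, output ip Phi M L ->
        representatives ip Phi
          (fun T : {fset E} => special_closed Phi T /\ #|` T| = n) L)) /\
  ((exists L : nat -> {fset {fset E}}, iteration ip Phi Phip L) /\
   (forall L : nat -> {fset {fset E}}, iteration ip Phi Phip L ->
      (forall k : nat, (0 < k < m)%N ->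
         representatives ip Phi
           (fun T : {fset E} => special_closed Phi T /\ #|` T| = k) (L k)) /\
      representatives ip Phi
        (fun T : {fset E} => special_closed Phi T /\ T <> fset0)
        (\bigcup_(k <- iota 1 m) L k))).
Proof.
have posP := positive_roots_system root_Phi pos_Phip; subst m.
split=> [n M lt_nm repM|].
  split; first exact: output_exists.
  by move=> L; exact: output_representatives posP lt_nm repM.
split; first exact: iteration_exists.
move=> L itL; split; last exact: iteration_union.
move=> k /andP[k_gt0 lt_km].
by apply: (iteration_representatives root_Phi posP itL); rewrite k_gt0 ltnW.
Qed.
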